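(* (i) Let $V$ be a simple $K$-weight $\mathcal{D}_q(\mathfrak{b}_{m,n})$-module. Then $\mathrm{supp}_K(V)=\{q^i\lambda \mid i\in\mathbb{Z}\}$ for some $\lambda\in\mathbb{K}^*$, and every $K$-weight space $V_{q^i\lambda}$ ($i\in\mathbb{Z}$) of $V$ is a simple $S$-module. In particular, every $K$-weight space of $V$ is infinite dimensional over $\mathbb{K}$. (ii) Let $W$ be a simple $a$-weight $\mathcal{D}_q(\mathfrak{b}_{m,n})$-module. Then $\mathrm{supp}_a(W)=\{q^i\mu \mid i\in\mathbb{Z}\}$ for some $\mu\in\mathbb{K}^*$, and every $a$-weight space $W^{q^i\mu}$ ($i\in\mathbb{Z}$) of $W$ is a simple $S$-module. In particular, every $a$-weight space of $W$ is infinite dimensional over $\mathbb{K}$.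
   Context: $\mathbb{K}$ is an algebraically closed field of characteristic zero, $\mathbb{K}^*=\mathbb{K}\setminus\{0\}$, $q\in\mathbb{K}^*$ is not a root of unity, and $m,n$ are nonzero integers. Modules are left modules. The Heisenberg double $\mathcal{D}_q(\mathfrak{b}_{m,n})$ is the unital associative $\mathbb{K}$-algebra generated by $a,a^{-1},b,c,K,K^{-1},E,F$ subject to the relations $ab=q^nba$, $ac=q^mca$, $bc=cb$, $aa^{-1}=a^{-1}a=1$; $KE=q^{2m}EK$, $KF=q^{-2n}FK$, $EF=FE$, $KK^{-1}=K^{-1}K=1$; $Ka=q^{-1}aK$, $Kb=q^nbK$, $Kc=q^{-m}cK$; $Ea=aE$, $Eb=bE$, $Ec=cE+a^{-m}K^m$; $Fa=q^naF$, $Fb=q^{-n^2}bF+a^n$, $Fc=q^{mn}cF$. Put $b'=a^nbK^{-n}$, $c'=a^{-m}cK^{-m}$, $E'=a^{2m}E$, $F'=q^{-n^2}a^{-2n}FK^n$, and let $S$ be the subalgebra of $\mathcal{D}_q(\mathfrak{b}_{m,n})$ generated by $b',c',E',F'$. (The elements of $S$ commute with $K$ and $a$, so $S$ preserves the weight spaces below.) A $\mathcal{D}_q(\mathfrak{b}_{m,n})$-module $V$ is a $K$-weight module if $V=\bigoplus_{\lambda\in\mathbb{K}^*}V_\lambda$ where $V_\lambda=\{v\in V: Kv=\lambda v\}$; its set of $K$-weights is $\mathrm{supp}_K(V)=\{\lambda\in\mathbb{K}^*: V_\lambda\neq 0\}$, and the nonzero $V_\lambda$ are its $K$-weight spaces.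 A $\mathcal{D}_q(\mathfrak{b}_{m,n})$-module $V$ is an $a$-weight module if $V=\bigoplus_{\mu\in\mathbb{K}^*}V^\mu$ where $V^\mu=\{v\in V: av=\mu v\}$; its set of $a$-weights is $\mathrm{supp}_a(V)=\{\mu\in\mathbb{K}^*: V^\mu\neq 0\}$, and the nonzero $V^\mu$ are its $a$-weight spaces. *)

(* Defs.v *)
From HB Require Import structures.
From mathcomp Require Import all_boot all_order all_algebra.
From mathcomp Require Import boolp classical_sets.

Set Implicit Arguments.
Unset Strict Implicit.
Unset Printing Implicit Defensive.

Import GRing.Theory.
Local Open Scope ring_scope.
Local Open Scope classical_set_scope.
Local Open Scope quotient_scope.

(* The unital associative k-algebra presented by generators G and relations
   rel: formal expressions modulo the least congruence that contains rel and
   makes the expressions an associative unital k-algebra.  Subtraction and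
   scaling are expressed by the constants Cst. *)
Inductive pterm (k : fieldType) (G : Type) : Type :=
  | Gen of G
  | Cst of k
  | Add of pterm k G & pterm k G
  | Mul of pterm k G & pterm k G.
Arguments Gen {k G}.
Arguments Cst {k G}.

HB.instance Definition _ (k : fieldType) (G : Type) :=
  gen_eqMixin (pterm k G).
HB.instance Definition _ (k : fieldType) (G : Type) :=
  gen_choiceMixin (pterm k G).

Declare Scope pterm_scope.
Delimit Scope pterm_scope with PT.
Notation "x + y" := (Add x y) : pterm_scope.
Notation "x * y" := (Mul x y) : pterm_scope.
Notation "c *: x" := (Mul (Cst c) x) : pterm_scope.

Section Presentation.
Context {k : fieldType} {G : Type}.
Implicit Types (rel : pterm k G -> pterm k G -> Prop) (s t u : pterm k G).

Inductive cong rel : pterm k G -> pterm k G -> Prop :=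
  | cong_rel s t : rel s t -> cong rel s t
  | cong_refl s : cong rel s s
  | cong_sym s t : cong rel s t -> cong rel t s
  | cong_trans s t u : cong rel s t -> cong rel t u -> cong rel s u
  | cong_add s s' t t' :
      cong rel s s' -> cong rel t t' -> cong rel (s + t)%PT (s' + t')%PT
  | cong_mul s s' t t' :
      cong rel s s' -> cong rel t t' -> cong rel (s * t)%PT (s' * t')%PT
  | cong_addA s t u : cong rel (s + (t + u))%PT ((s + t) + u)%PT
  | cong_addC s t : cong rel (s + t)%PT (t + s)%PT
  | cong_add0 s : cong rel (Cst 0 + s)%PT s
  | cong_addN s : cong rel (((-1) *: s) + s)%PT (Cst 0)
  | cong_mulA s t u : cong rel (s * (t * u))%PT ((s * t) * u)%PT
  | cong_mul1 s : cong rel (Cst 1 * s)%PT s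
  | cong_mulDl s t u : cong rel ((s + t) * u)%PT (s * u + t * u)%PT
  | cong_mulDr s t u : cong rel (s * (t + u))%PT (s * t + s * u)%PT
  | cong_cstD c d : cong rel (Cst (c + d)) (Cst c + Cst d)%PT
  | cong_cstM c d : cong rel (Cst (c * d)) (Cst c * Cst d)%PT
  | cong_cstC c s : cong rel (Cst c * s)%PT (s * Cst c)%PT.

Definition congb rel s t : bool := `[< cong rel s t >].

Fact congb_refl rel : reflexive (congb rel).
Proof. by move=> s; apply/asboolP; apply: cong_refl. Qed.

Fact congb_sym rel : symmetric (congb rel).
Proof. by move=> s t; apply/asboolP/asboolP => /cong_sym. Qed.

Fact congb_trans rel : transitive (congb rel).
Proof.
move=> t s u /asboolP st /asboolP tu; apply/asboolP.
exact: cong_trans st tu.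
Qed.

Canonical cong_equiv rel :=
  EquivRel (congb rel) (congb_refl rel) (congb_sym rel) (@congb_trans rel).

Definition presAlg rel : Type := {eq_quot cong_equiv rel}.

HB.instance Definition _ rel := Choice.on (presAlg rel).

Definition pcls rel (t : pterm k G) : presAlg rel :=
  \pi_({eq_quot cong_equiv rel}) t.

Section Structure.
Variable rel : pterm k G -> pterm k G -> Prop.
Local Notation A := (presAlg rel).
Local Notation cls := (pcls rel).

Definition prepr (x : A) : pterm k G :=
  repr (x : {eq_quot cong_equiv rel}).

Lemma pcls_eq s t : cls s = cls t <-> cong rel s t.
Proof.
split=> [/eqmodP /asboolP // | st].
by apply/eqmodP; apply/asboolP.
Qed.

Lemma preprK x : cls (prepr x) = x.
Proof. exact: reprK. Qed.

Lemma pclsP (P : A -> Prop) : (forall t, P (cls t)) -> forall x, P x.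
Proof. by move=> Pt x; rewrite -(preprK x). Qed.

Definition padd (x y : A) : A := cls (prepr x + prepr y)%PT.
Definition pmul (x y : A) : A := cls (prepr x * prepr y)%PT.
Definition popp (x : A) : A := cls ((-1) *: prepr x)%PT.
Definition pscale (c : k) (x : A) : A := cls (c *: prepr x)%PT.

Lemma cong_repr s : cong rel (prepr (cls s)) s.
Proof. by apply/pcls_eq; rewrite preprK. Qed.

Lemma paddE s t : padd (cls s) (cls t) = cls (s + t)%PT.
Proof. by apply/pcls_eq; apply: cong_add; apply: cong_repr. Qed.

Lemma pmulE s t : pmul (cls s) (cls t) = cls (s * t)%PT.
Proof. by apply/pcls_eq; apply: cong_mul; apply: cong_repr. Qed.

Lemma poppE s : popp (cls s) = cls ((-1) *: s)%PT.
Proof.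
by apply/pcls_eq; apply: cong_mul; [apply: cong_refl | apply: cong_repr].
Qed.

Lemma pscaleE c s : pscale c (cls s) = cls (c *: s)%PT.
Proof.
by apply/pcls_eq; apply: cong_mul; [apply: cong_refl | apply: cong_repr].
Qed.

Fact paddA : associative padd.
Proof.
elim/pclsP=> s; elim/pclsP=> t; elim/pclsP=> u.
by rewrite !paddE; apply/pcls_eq/cong_addA.
Qed.

Fact paddC : commutative padd.
Proof.
by elim/pclsP=> s; elim/pclsP=> t; rewrite !paddE; apply/pcls_eq/cong_addC.
Qed.

Fact padd0 : left_id (cls (Cst 0)) padd.
Proof. by elim/pclsP=> s; rewrite paddE; apply/pcls_eq/cong_add0. Qed.

Fact paddN : left_inverse (cls (Cst 0)) popp padd.
Proof. by elim/pclsP=> s; rewrite poppE paddE; apply/pcls_eq/cong_addN. Qed.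

Fact pmulA : associative pmul.
Proof.
elim/pclsP=> s; elim/pclsP=> t; elim/pclsP=> u.
by rewrite !pmulE; apply/pcls_eq/cong_mulA.
Qed.

Fact pmul1 : left_id (cls (Cst 1)) pmul.
Proof. by elim/pclsP=> s; rewrite pmulE; apply/pcls_eq/cong_mul1. Qed.

Fact pmulr1 : right_id (cls (Cst 1)) pmul.
Proof.
elim/pclsP=> s; rewrite pmulE; apply/pcls_eq.
exact: cong_trans (cong_sym (cong_cstC _ _ _)) (cong_mul1 _ _).
Qed.

Fact pmulDl : left_distributive pmul padd.
Proof.
elim/pclsP=> s; elim/pclsP=> t; elim/pclsP=> u.
by rewrite !(pmulE, paddE); apply/pcls_eq/cong_mulDl.
Qed.

Fact pmulDr : right_distributive pmul padd.
Proof.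
elim/pclsP=> s; elim/pclsP=> t; elim/pclsP=> u.
by rewrite !(pmulE, paddE); apply/pcls_eq/cong_mulDr.
Qed.

(* A presented algebra may collapse to 0, so it is only a pzRingType; this
   rules out the library's algType, which is nontrivial by definition.  The
   k-algebra structure is the pzRingType and lmodType k structures together
   with presAlg_scaleAl and presAlg_scaleAr. *)
HB.instance Definition _ :=
  GRing.isPzRing.Build A paddA paddC padd0 paddN
    pmulA pmul1 pmulr1 pmulDl pmulDr.

Fact pscaleA c d x : pscale c (pscale d x) = pscale (c * d) x.
Proof.
elim/pclsP: x => s; rewrite !pscaleE; apply/pcls_eq.
apply: cong_trans (cong_mulA _ _ _ _) _.
exact: cong_mul (cong_sym (cong_cstM _ _ _)) (cong_refl _ _).
Qed.

Fact pscale1 : left_id 1 pscale.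
Proof. by elim/pclsP=> s; rewrite pscaleE; apply/pcls_eq/cong_mul1. Qed.

Fact pscaleDr : right_distributive pscale +%R.
Proof.
move=> c; elim/pclsP=> s; elim/pclsP=> t.
rewrite -[cls s + cls t]/(padd _ _) -[RHS]/(padd _ _) !(paddE, pscaleE).
exact/pcls_eq/cong_mulDr.
Qed.

Fact pscaleDl x : {morph pscale^~ x : c d / c + d}.
Proof.
move=> c d; elim/pclsP: x => s.
rewrite -[RHS]/(padd _ _) !pscaleE paddE; apply/pcls_eq.
apply: cong_trans (cong_mulDl _ _ _ _).
exact: cong_mul (cong_cstD _ _ _) (cong_refl _ _).
Qed.

HB.instance Definition _ :=
  GRing.Zmodule_isLmodule.Build k A pscaleA pscale1 pscaleDr pscaleDl.

Lemma presAlg_scaleAl (c : k) (x y : A) : c *: (x * y) = (c *: x) * y.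
Proof.
elim/pclsP: x => s; elim/pclsP: y => t.
rewrite -[LHS]/(pscale c (pmul _ _)) -[RHS]/(pmul (pscale c _) _).
rewrite !(pmulE, pscaleE).
exact/pcls_eq/cong_mulA.
Qed.

Lemma presAlg_scaleAr (c : k) (x y : A) : c *: (x * y) = x * (c *: y).
Proof.
elim/pclsP: x => s; elim/pclsP: y => t.
rewrite -[LHS]/(pscale c (pmul _ _)) -[RHS]/(pmul _ (pscale c _)).
rewrite !(pmulE, pscaleE); apply/pcls_eq.
apply: cong_trans (cong_mulA _ _ _ _) _.
apply: cong_trans (cong_sym (cong_mulA _ _ _ _)).
exact: cong_mul (cong_cstC _ _ _) (cong_refl _ _).
Qed.

Lemma pclsD s t : cls (s + t)%PT = cls s + cls t.
Proof. by rewrite -paddE. Qed.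

Lemma pclsM s t : cls (s * t)%PT = cls s * cls t.
Proof. by rewrite -pmulE. Qed.

Lemma pclsZ c s : cls (c *: s)%PT = c *: cls s.
Proof. by rewrite -pscaleE. Qed.

Lemma pclsC c : cls (Cst c) = c *: (1 : A).
Proof.
rewrite -[RHS]/(pscale c (cls (Cst 1))) pscaleE; apply/pcls_eq.
apply: cong_trans (cong_sym (cong_cstC _ _ _)).
exact/cong_sym/cong_mul1.
Qed.

Lemma pcls_rel s t : rel s t -> cls s = cls t.
Proof. by move=> st; apply/pcls_eq/cong_rel. Qed.

(* The universal property of the presentation. *)
Fixpoint teval (B : algType k) (g : G -> B) (t : pterm k G) : B :=
  match t with
  | Gen x => g x
  | Cst c => c *: 1
  | Add s t => teval g s + teval g t
  | Mul s t => teval g s * teval g t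
  end.

Lemma presAlg_universal (B : algType k) (g : G -> B) :
    (forall s t, rel s t -> teval g s = teval g t) ->
  exists! f : A -> B,
    [/\ forall x, f (cls (Gen x)) = g x,
        f 1 = 1,
        {morph f : x y / x + y},
        {morph f : x y / x * y}
      & forall c x, f (c *: x) = c *: f x].
Proof.
move=> grel.
have gcong s t : cong rel s t -> teval g s = teval g t.
  elim=> //=; do ?by move=> *; congruence.
  - by move=> *; rewrite addrA.
  - by move=> *; rewrite addrC.
  - by move=> *; rewrite scale0r add0r.
  - by move=> u; rewrite -scalerAl mul1r scaleN1r addNr scale0r.
  - by move=> *; rewrite mulrA.
  - by move=> *; rewrite scale1r mul1r.
  - by move=> *; rewrite mulrDl.
  - by move=> *; rewrite mulrDr.
  - by move=> *; rewrite scalerDl.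
  - by move=> *; rewrite -scalerAl mul1r scalerA.
  - by move=> *; rewrite -scalerAl -scalerAr mul1r mulr1.
pose f (x : A) := teval g (prepr x).
have fE t : f (cls t) = teval g t by apply/gcong/cong_repr.
exists f; split.
  split=> [x||||].
  - by rewrite fE.
  - by rewrite -[1]/(cls (Cst 1)) fE /= scale1r.
  - by elim/pclsP=> s; elim/pclsP=> t; rewrite -pclsD !fE.
  - by elim/pclsP=> s; elim/pclsP=> t; rewrite -pclsM !fE.
  - by move=> c; elim/pclsP=> s; rewrite -pclsZ !fE /= -scalerAl mul1r.
move=> h [hg h1 hD hM hZ]; apply/funext; elim/pclsP; elim=> [x|c|s IHs t IHt|s IHs t IHt].
- by rewrite fE hg.
- by rewrite fE pclsC hZ h1.
- by rewrite fE pclsD hD -IHs -IHt !fE.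
- by rewrite fE pclsM hM -IHs -IHt !fE.
Qed.

End Structure.
End Presentation.

Inductive hd_gen := ga | gai | gb | gc | gK | gKi | gE | gF.

Section HeisenbergDouble.
Context {k : fieldType}.
Local Notation trm := (pterm k hd_gen).

(* tpow x xi j is the integer power x^j, where xi stands for the inverse
   of x. *)
Definition tpow (x xi : trm) (j : int) : trm :=
  match j with
  | Posz i => iter i (Mul x) (Cst 1)
  | Negz i => iter i.+1 (Mul xi) (Cst 1)
  end.

Let a : trm := Gen ga.
Let a' : trm := Gen gai.
Let b : trm := Gen gb.
Let c : trm := Gen gc.
Let K : trm := Gen gK.
Let K' : trm := Gen gKi.
Let E : trm := Gen gE.
Let F : trm := Gen gF.
Local Open Scope pterm_scope.

Inductive hd_rel (q : k) (m n : int) : trm -> trm -> Prop :=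
  | rel_ab : hd_rel q m n (a * b) ((q ^ n)%R *: (b * a))
  | rel_ac : hd_rel q m n (a * c) ((q ^ m)%R *: (c * a))
  | rel_bc : hd_rel q m n (b * c) (c * b)
  | rel_aV : hd_rel q m n (a * a') (Cst 1)
  | rel_Va : hd_rel q m n (a' * a) (Cst 1)
  | rel_KE : hd_rel q m n (K * E) ((q ^ (2 * m))%R *: (E * K))
  | rel_KF : hd_rel q m n (K * F) ((q ^ (- (2 * n)))%R *: (F * K))
  | rel_EF : hd_rel q m n (E * F) (F * E)
  | rel_KV : hd_rel q m n (K * K') (Cst 1)
  | rel_VK : hd_rel q m n (K' * K) (Cst 1)
  | rel_Ka : hd_rel q m n (K * a) ((q ^ (-1))%R *: (a * K))
  | rel_Kb : hd_rel q m n (K * b) ((q ^ n)%R *: (b * K))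
  | rel_Kc : hd_rel q m n (K * c) ((q ^ (- m))%R *: (c * K))
  | rel_Ea : hd_rel q m n (E * a) (a * E)
  | rel_Eb : hd_rel q m n (E * b) (b * E)
  | rel_Ec : hd_rel q m n (E * c) (c * E + tpow a a' (- m)%R * tpow K K' m)
  | rel_Fa : hd_rel q m n (F * a) ((q ^ n)%R *: (a * F))
  | rel_Fb : hd_rel q m n (F * b)
                          ((q ^ (- (n ^+ 2)))%R *: (b * F) + tpow a a' n)
  | rel_Fc : hd_rel q m n (F * c) ((q ^ (m * n))%R *: (c * F)).

End HeisenbergDouble.

(* D_q(b_{m,n}) *)
Notation hdouble q m n := (presAlg (hd_rel q m n)).

Section Elements.
Context {k : fieldType} (q : k) (m n : int).
Local Notation D := (hdouble q m n).

Definition hd (g : hd_gen) : D := pcls (hd_rel q m n) (Gen g).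

Definition hd_apow (j : int) : D := pcls _ (tpow (Gen ga) (Gen gai) j).
Definition hd_Kpow (j : int) : D := pcls _ (tpow (Gen gK) (Gen gKi) j).

Definition hd_b' : D := hd_apow n * hd gb * hd_Kpow (- n).
Definition hd_c' : D := hd_apow (- m) * hd gc * hd_Kpow (- m).
Definition hd_E' : D := hd_apow (2 * m) * hd gE.
Definition hd_F' : D :=
  q ^ (- (n ^+ 2)) *: (hd_apow (- (2 * n)) * hd gF * hd_Kpow n).

End Elements.

Definition subalgebra (k : fieldType) (G : Type)
    (rel : pterm k G -> pterm k G -> Prop) (B : set (presAlg rel)) : Prop :=
  [/\ B 1,
      forall x y, B x -> B y -> B (x + y),
      forall x y, B x -> B y -> B (x * y)
    & forall (c : k) x, B x -> B (c *: x)].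

Definition hd_S (k : fieldType) (q : k) (m n : int) : set (hdouble q m n) :=
  smallest (@subalgebra k hd_gen (hd_rel q m n))
    [set x | [\/ x = hd_b' q m n, x = hd_c' q m n,
                 x = hd_E' q m n | x = hd_F' q m n]].

Arguments hd_S {k} q m n _.

Section Modules.
Context {R : pzRingType} {V : lmodType R}.
Implicit Types (B : set R) (U W : set V).

(* U is a module over the subring B of R; B is meant to contain -1, so that
   closure under opposite follows. *)
Definition is_module B U : Prop :=
  [/\ U 0,
      forall u v, U u -> U v -> U (u + v)
    & forall x u, B x -> U u -> U (x *: u)].

Definition is_simple B U : Prop :=
  [/\ is_module B U,
      U <> [set 0]
    & forall W, W `<=` U -> is_module B W -> W = [set 0] \/ W = U].

End Modules.

Definition is_direct_sum (V : zmodType) (I : eqType) (J : set I)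
    (U : I -> set V) : Prop :=
  let family (s : seq I) (f : I -> V) :=
    uniq s /\ {in s, forall i, J i /\ U i (f i)} in
  (forall v, exists s f, family s f /\ v = \sum_(i <- s) f i) /\
  (forall s f, family s f -> \sum_(i <- s) f i = 0 ->
     {in s, forall i, f i = 0}).

Section Weights.
Context {k : fieldType} {G : Type} {rel : pterm k G -> pterm k G -> Prop}.
Local Notation A := (presAlg rel).

(* A module V over the k-algebra A is a k-vector space through
   c |-> c *: 1 : A. *)
Definition weight_space (V : lmodType A) (x : A) (l : k) : set V :=
  [set v | x *: v = (l *: (1 : A)) *: v].
Arguments weight_space : clear implicits.

Definition weight_module (V : lmodType A) (x : A) : Prop :=
  is_direct_sum [set l : k | l != 0] (weight_space V x).

Definition weight_supp (V : lmodType A) (x : A) : set k :=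
  [set l | l != 0 /\ weight_space V x l <> [set 0]].

Definition finite_dim (V : lmodType A) (U : set V) : Prop :=
  exists s : seq V, {in s, forall v, U v} /\
    forall v, U v -> exists c : nat -> k,
      v = \sum_(i < size s) (c i *: (1 : A)) *: s`_i.

End Weights.
Arguments weight_space {k G rel} V x l _.
Arguments weight_module {k G rel} V x.
Arguments weight_supp {k G rel} V x _.
Arguments finite_dim {k G rel V} U.

(* Main.v *)
Require Import Defs.
From mathcomp Require Import all_boot all_order all_algebra.
From mathcomp Require Import boolp classical_sets.
From mathcomp Require Import ring zify.

Set Implicit Arguments.
Unset Strict Implicit.
Unset Printing Implicit Defensive.

Import GRing.Theory.
Local Open Scope ring_scope.
Local Open Scope classical_set_scope.

(** Write S for the subalgebra generated by b', c', E', F'.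

    The proof rests on S being the part of the algebra that neither a nor K
    sees: every element of S commutes with both, and S, a, K and their inverses
    generate everything ([hd_S_comm], [hd_generated_by_S]).  Since K and a
    commute up to a power of q, the element a^-1 moves the K-weight space of
    weight l isomorphically onto that of weight q l, and K does the same for
    a-weights; so the two halves of the theorem are one statement about a pair
    x, y with x y = q y x that centralises S ([simple_weight_module]).

    For that statement, let U be a nonzero S-submodule of the x-weight space
    V_l.  The sum of all y^i U is stable under S, y and x, hence is a submodule,
    hence is V by simplicity.  As q is not a root of unity, the summands have
    pairwise distinct weights q^i l, so the part of weight l in that sum is U
    alone.  This gives both the support of V and U = V_l, which is the
    simplicity of V_l over S.

    Weight spaces are infinite dimensional because S has no nonzero finite
    dimensional module.  In S, with p1 = q^(2 m^2) and p2 = q^(-2 n^2),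
      E' c' = 1 + p1 c' E',   F' b' = 1 + p2 b' F',   E' F' = q^(-2 m n) F' E'.
    The first relation alone does have one dimensional modules, but in every
    finite dimensional one E' is invertible: otherwise all the p1-integers
    0, 1, 1 + p1, ..., which are distinct, would be eigenvalues of c' E'
    ([qweyl_unitmx]).  Likewise F' is invertible, and determinants turn the
    third relation into (q^(-2 m n))^d = 1 in dimension d
    ([qweyl_pair_infinite_dim]), which forces d = 0. *)

(** * Matrices satisfying a quantum Weyl relation *)

Section Matrices.
Variable k : fieldType.

Lemma exprn_inj_not_root1 (p : k) : p != 0 ->
  (forall j : nat, (0 < j)%N -> p ^+ j != 1) -> injective (fun j : nat => p ^+ j).
Proof.
move=> p0 pn1 i j; wlog le_ij : i j / (i <= j)%N.
  by move=> wl pij; case/orP: (leq_total i j) => ?; [|apply/esym]; apply: wl.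
move=> /= pij; apply/eqP; rewrite eqn_leq le_ij /= leqNgt; apply/negP => lt_ij.
have /pn1/negP[] : (0 < j - i)%N by rewrite subn_gt0.
by rewrite -(inj_eq (mulfI (expf_neq0 i p0))) -exprD subnKC // mulr1 pij.
Qed.

(** Let [v] be a row eigenvector of [X *m Y] with eigenvalue t.  It is also one
    of [Y *m X], with eigenvalue 1 + p t; and [X *m Y], [Y *m X] have the same
    nonzero eigenvalues.  If [X] were singular, 0 would be an eigenvalue, and
    iterating t |-> 1 + p t from it would give infinitely many. *)
Lemma qweyl_unitmx (p : k) (N : nat) (X Y : 'M[k]_N) : p != 0 ->
  (forall j : nat, (0 < j)%N -> p ^+ j != 1) ->
  Y *m X = 1%:M + p *: (X *m Y) -> X \in unitmx.
Proof.
move=> p0 pn1 YX; rewrite unitmxE unitfE; apply/negP => /eqP detX.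
(* br j is the p-integer 1 + p + ... + p^(j-1), the orbit of 0 under
   t |-> 1 + p t. *)
pose br j := \sum_(i < j) p ^+ i.
have p1 : p - 1 != 0 by rewrite subr_eq0 -[p]expr1 pn1.
have br_inj : injective br.
  move=> i j brij; apply: (exprn_inj_not_root1 p0 pn1).
  by apply: (addIr (-1)); rewrite !subrX1; congr (_ * _).
have brS j : br j.+1 = 1 + p * br j.
  rewrite /br big_ord_recl expr0 mulr_sumr; congr (_ + _).
  by apply: eq_bigr => i _; rewrite -exprS.
have br0 : br 0%N = 0 by rewrite /br big_ord0.
have evXY j : eigenvalue (X *m Y) (br j).
  elim: j => [|j /eigenvalueP[v vXY v0]].
    rewrite br0 /eigenvalue /eigenspace raddf0 subr0.
    rewrite kermx_eq0 row_free_unit unitmxE det_mulmx detX mul0r.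
    by rewrite unitr0.
  have vYX : v *m Y *m X = br j.+1 *: v.
    by rewrite -mulmxA YX mulmxDr mulmx1 -scalemxAr vXY brS scalerDl scale1r scalerA.
  apply/eigenvalueP; exists (v *m Y); first by rewrite mulmxA vYX -scalemxAl.
  apply/eqP => vY; move/eqP: vYX; rewrite vY mul0mx eq_sym scaler_eq0 (negPf v0) orbF.
  by rewrite -br0 (inj_eq br_inj).
(* N + 1 distinct roots of a polynomial of degree N. *)
have := @max_poly_roots _ (char_poly (X *m Y)) (map br (iota 0 N.+1)).
rewrite size_map size_iota size_char_poly ltnn (map_inj_uniq br_inj) iota_uniq.
rewrite -size_poly_eq0 size_char_poly => /(_ isT) H.
suff /H/(_ isT) : all (root (char_poly (X *m Y))) (map br (iota 0 N.+1)) by [].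
by apply/allP => _ /mapP[j _ ->]; rewrite -eigenvalue_root_char.
Qed.

End Matrices.

(** * Finite dimensional subspaces of a module *)

Section FiniteDim.
Context {k : fieldType} {G : Type} {rel : pterm k G -> pterm k G -> Prop}.
Local Notation A := (presAlg rel).
Variable V : lmodType A.
Implicit Types (U : set V) (x y z : A) (c d : k).

Lemma cstD c d : (c + d) *: (1 : A) = c *: (1 : A) + d *: (1 : A).
Proof. exact: scalerDl. Qed.

Lemma cst_central c z : (c *: (1 : A)) * z = z * (c *: (1 : A)).
Proof. by rewrite -presAlg_scaleAl -presAlg_scaleAr mulr1 mul1r. Qed.

Lemma cstM c d : (c * d) *: (1 : A) = (c *: (1 : A)) * (d *: (1 : A)).
Proof. by rewrite -presAlg_scaleAl mul1r scalerA. Qed.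

Lemma cst_scale c z (v : V) : (c *: z) *: v = (c *: (1 : A)) *: (z *: v).
Proof. by rewrite scalerA -presAlg_scaleAl mul1r. Qed.

Lemma scaler_cst z c (v : V) :
  z *: ((c *: (1 : A)) *: v) = (c *: (1 : A)) *: (z *: v).
Proof. by rewrite !scalerA cst_central. Qed.

Lemma cst_inj c (v : V) : c != 0 -> (c *: (1 : A)) *: v = 0 -> v = 0.
Proof.
move=> c0 /(congr1 (fun w => (c^-1 *: (1 : A)) *: w)).
by rewrite scaler0 scalerA -cstM mulVf // scale1r scale1r.
Qed.

(** Scalars act on [V] only through the multiples of 1 in [A]. *)
Definition lincomb N (e : 'I_N -> V) (w : 'rV[k]_N) : V :=
  \sum_i (w 0 i *: (1 : A)) *: e i.

Lemma lincombD N (e : 'I_N -> V) u w :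
  lincomb e (u + w) = lincomb e u + lincomb e w.
Proof.
by rewrite -big_split; apply: eq_bigr => i _; rewrite mxE cstD scalerDl.
Qed.

Lemma lincombZ N (e : 'I_N -> V) c w :
  lincomb e (c *: w) = (c *: (1 : A)) *: lincomb e w.
Proof.
rewrite /lincomb scaler_sumr; apply: eq_bigr => i _.
by rewrite mxE cstM -scalerA.
Qed.

Lemma lincomb_sum N M (e : 'I_N -> V) (c : 'I_M -> k) (w : 'I_M -> 'rV_N) :
  lincomb e (\sum_i c i *: w i) = \sum_i (c i *: (1 : A)) *: lincomb e (w i).
Proof.
pose h := lincomb e; have h0 : h 0 = 0.
  by rewrite -(scale0r (0 : 'rV_N)) /h lincombZ scale0r scale0r.
rewrite -/h (big_morph h (lincombD e) h0).
by apply: eq_bigr => i _; rewrite /h lincombZ.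
Qed.

Definition lin_closed U :=
  [/\ U 0, forall u v, U u -> U v -> U (u + v)
    & forall c v, U v -> U ((c *: (1 : A)) *: v)].

(** A spanning family of minimal size is free: a relation with a nonzero
    coefficient at [i0] would allow [e i0] to be dropped. *)
Lemma finite_dim_basis U : lin_closed U -> finite_dim U ->
  exists N (e : 'I_N -> V),
    [/\ forall w, U (lincomb e w), forall v, U v -> exists w, v = lincomb e w
      & forall w, lincomb e w = 0 -> w = 0].
Proof.
move=> [U0 UD UZ] [s [sU sgen]].
pose gen N (e : 'I_N -> V) :=
  (forall i, U (e i)) /\ (forall v, U v -> exists w, v = lincomb e w).
have exN : exists N, `[< exists e : 'I_N -> V, gen N e >].
  exists (size s); apply/asboolP; exists (fun i => s`_i); split.
    by move=> i; apply: sU; rewrite mem_nth.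
  move=> v /sgen[c ->]; exists (\row_i c i).
  by apply: eq_bigr => i _; rewrite mxE.
case: (ex_minnP exN) => N /asboolP[e [eU egen]] minN.
exists N, e; split=> // [w|w w_rel].
  by rewrite /lincomb; elim/big_ind: _ => // i _; apply: UZ.
apply/eqP; apply: contraT => /rV0Pn[i0 wi0].
case: N => [|N] in e eU egen minN w w_rel i0 wi0 *; first by case: (i0).
have /minN : `[< exists e : 'I_N -> V, gen N e >]; last by rewrite ltnn.
apply/asboolP; exists (fun j => e (lift i0 j)); split=> // v /egen[u ->].
(* Subtracting a multiple of the relation w clears the coefficient at i0. *)
pose u' := u + (- (u 0 i0 / w 0 i0)) *: w.
have -> : lincomb e u = lincomb e u'.
  by rewrite lincombD lincombZ w_rel scaler0 addr0.
exists (\row_j u' 0 (lift i0 j)).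
rewrite /lincomb (bigD1_ord i0) //=.
have -> : u' 0 i0 = 0 by rewrite !mxE mulNr divfK // subrr.
rewrite scale0r scale0r add0r.
by apply: eq_bigr => j _; rewrite mxE.
Qed.

Lemma matrix_of_action U N (e : 'I_N -> V) z :
    (forall w, U (lincomb e w)) -> (forall v, U v -> exists w, v = lincomb e w) ->
    (forall v, U v -> U (z *: v)) ->
  exists Z : 'M[k]_N, forall w, z *: lincomb e w = lincomb e (w *m Z).
Proof.
move=> eU egen zU.
have ze i : exists w, z *: e i = lincomb e w.
  apply/egen/zU; suff <- : lincomb e (delta_mx 0 i) = e i by [].
  rewrite /lincomb (bigD1 i) //= big1 ?addr0 => [|j ji].
    by rewrite mxE !eqxx scale1r scale1r.
  by rewrite mxE (negPf ji) andbF scale0r scale0r.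
have [f fP] := choice ze.
exists (\matrix_i f i) => w.
rewrite mulmx_sum_row lincomb_sum scaler_sumr; apply: eq_bigr => i _.
by rewrite scaler_cst fP rowK.
Qed.

(** In a basis of a finite dimensional [U], both [x1] and [x2] have invertible
    matrices by [qweyl_unitmx]; comparing the determinants in [x1 * x2 = r x2 x1]
    gives r^N = 1, so the basis is empty. *)
Lemma qweyl_pair_infinite_dim U (p1 p2 r : k) (x1 y1 x2 y2 : A) :
    lin_closed U -> U <> [set 0] ->
    (forall v, U v -> [/\ U (x1 *: v), U (y1 *: v), U (x2 *: v) & U (y2 *: v)]) ->
    p1 != 0 -> p2 != 0 ->
    (forall j, (0 < j)%N -> p1 ^+ j != 1) ->
    (forall j, (0 < j)%N -> p2 ^+ j != 1) ->
    (forall j, (0 < j)%N -> r ^+ j != 1) ->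
    x1 * y1 = 1 + p1 *: (y1 * x1) -> x2 * y2 = 1 + p2 *: (y2 * x2) ->
    x1 * x2 = r *: (x2 * x1) ->
  ~ finite_dim U.
Proof.
move=> linU U0 stab p10 p20 p1n p2n rn w1 w2 xx fin.
have [N [e [eU egen efree]]] := finite_dim_basis linU fin.
have mx z : (forall v, U v -> U (z *: v)) -> _ := matrix_of_action eU egen.
have [X1 X1P] := mx x1 (fun v Uv => let: And4 h _ _ _ := stab v Uv in h).
have [Y1 Y1P] := mx y1 (fun v Uv => let: And4 _ h _ _ := stab v Uv in h).
have [X2 X2P] := mx x2 (fun v Uv => let: And4 _ _ h _ := stab v Uv in h).
have [Y2 Y2P] := mx y2 (fun v Uv => let: And4 _ _ _ h := stab v Uv in h).
have lc_inj (B C : 'M[k]_N) :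
    (forall w, lincomb e (w *m B) = lincomb e (w *m C)) -> B = C.
  move=> BC; apply/row_matrixP => i; rewrite !rowE; apply/eqP.
  rewrite -subr_eq0 -scaleN1r; apply/eqP/efree.
  rewrite lincombD lincombZ BC -lincombZ -lincombD scaleN1r subrr.
  by rewrite -(scale0r (0 : 'rV_N)) lincombZ !scale0r.
(* Coordinates are rows, so a product of operators becomes the product of
   their matrices in the opposite order. *)
have weyl p x y X Y : (forall w, x *: lincomb e w = lincomb e (w *m X)) ->
    (forall w, y *: lincomb e w = lincomb e (w *m Y)) ->
    x * y = 1 + p *: (y * x) -> Y *m X = 1%:M + p *: (X *m Y).
  move=> xX yY xy; apply: lc_inj => w.
  rewrite mulmxDr mulmx1 -scalemxAr lincombD lincombZ !mulmxA -!xX -!yY -xX.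
  by rewrite !scalerA -!presAlg_scaleAl mul1r xy scalerDl scale1r.
have X1u := qweyl_unitmx p10 p1n (weyl _ _ _ _ _ X1P Y1P w1).
have X2u := qweyl_unitmx p20 p2n (weyl _ _ _ _ _ X2P Y2P w2).
have /(congr1 determinant) : X2 *m X1 = r *: (X1 *m X2).
  apply: lc_inj => w.
  rewrite -scalemxAr lincombZ !mulmxA -X1P -X2P -X2P -X1P.
  by rewrite !scalerA -!presAlg_scaleAl mul1r xx.
rewrite detZ !det_mulmx [LHS]mulrC -[LHS]mul1r.
move: X1u X2u; rewrite !unitmxE !unitfE => d1 d2.
move/(mulIf (mulf_neq0 d1 d2))/esym/eqP; apply/negP/rn.
rewrite lt0n; apply/eqP => N0.
apply: U0; apply/seteqP; split=> v /=; last by move=> ->; case: linU.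
case/egen=> w ->; rewrite /lincomb big1 // => i _.
by have := ltn_ord i; rewrite [X in (_ < X)%N]N0.
Qed.

End FiniteDim.

(** * Integer powers and commutation up to a scalar *)

Section IntegerPowers.
Variable R : pzRingType.

Definition zpow (x xi : R) (j : int) : R :=
  match j with Posz i => x ^+ i | Negz i => xi ^+ i.+1 end.

Variables x xi : R.
Hypotheses (xV : x * xi = 1) (Vx : xi * x = 1).

Lemma zpowS j : zpow x xi (j + 1) = x * zpow x xi j.
Proof.
case: j => [i|[|i]]; first by rewrite -PoszD addn1 /= exprS.
  by rewrite /= expr1 xV expr0.
have -> : Negz i.+1 + 1 = Negz i by lia.
by rewrite /= (exprS _ i.+1) mulrA xV mul1r.
Qed.

Lemma zpowB1 j : zpow x xi (j - 1) = xi * zpow x xi j.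
Proof. by rewrite -[in RHS](subrK 1 j) zpowS mulrA Vx mul1r. Qed.

Lemma zpowD i j : zpow x xi (i + j) = zpow x xi i * zpow x xi j.
Proof.
elim: i => [|i IHi|i IHi]; first by rewrite add0r /= mul1r.
  by rewrite -addn1 PoszD addrAC !zpowS IHi mulrA.
by rewrite -addn1 PoszD opprD addrAC !zpowB1 IHi mulrA.
Qed.

Lemma zpowNK j z : zpow x xi (- j) * (zpow x xi j * z) = z.
Proof. by rewrite mulrA -zpowD addNr /= mul1r. Qed.

Lemma zpowKN j z : zpow x xi j * (zpow x xi (- j) * z) = z.
Proof. by rewrite mulrA -zpowD subrr /= mul1r. Qed.

Lemma comm_zpow j z : GRing.comm z x -> GRing.comm z (zpow x xi j).
Proof.
move=> zx; have zxi : GRing.comm z xi.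
  by rewrite /GRing.comm -[z * xi]mul1r -Vx -mulrA (mulrA x) -zx -mulrA xV mulr1.
by case: j => i; apply: commrX.
Qed.

End IntegerPowers.

Section ScalarCommutation.
Context {k : fieldType} {G : Type} {rel : pterm k G -> pterm k G -> Prop}.
Local Notation A := (presAlg rel).
Implicit Types (x y z : A) (r s : k).

Definition scomm r x y := x * y = r *: (y * x).

Lemma scomm_sym r x y : r != 0 -> scomm r x y -> scomm r^-1 y x.
Proof. by move=> r0 xy; rewrite /scomm xy scalerA mulVf // scale1r. Qed.

Lemma scommMr r s x y z : scomm r x y -> scomm s x z -> scomm (r * s) x (y * z).
Proof.
move=> xy xz; rewrite /scomm mulrA xy -presAlg_scaleAl -mulrA xz.
by rewrite -presAlg_scaleAr scalerA mulrA.
Qed.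

Lemma scommMl r s x y z : scomm r x z -> scomm s y z -> scomm (r * s) (x * y) z.
Proof.
move=> xz yz; rewrite /scomm -mulrA yz -presAlg_scaleAr mulrA xz.
by rewrite -presAlg_scaleAl scalerA mulrA (mulrC s).
Qed.

Lemma scomm_inv r x y yi : r != 0 -> y * yi = 1 -> yi * y = 1 ->
  scomm r x y -> scomm r^-1 x yi.
Proof.
move=> r0 yV Vy xy; rewrite /scomm -[x * yi]mul1r -Vy -mulrA (mulrA y).
have -> : y * x = r^-1 *: (x * y) by rewrite xy scalerA mulVf // scale1r.
by rewrite -presAlg_scaleAl -presAlg_scaleAr -!mulrA yV mulr1.
Qed.

Lemma scomm1 x : scomm 1 x 1.
Proof. by rewrite /scomm scale1r mul1r mulr1. Qed.

Lemma scommX r x y i : scomm r x y -> scomm (r ^+ i) x (y ^+ i).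
Proof.
move=> xy; elim: i => [|i IHi]; first exact: scomm1.
by rewrite !exprS; apply: scommMr.
Qed.

Lemma scomm_zpow r x y yi j : r != 0 -> y * yi = 1 -> yi * y = 1 ->
  scomm r x y -> scomm (r ^ j) x (zpow y yi j).
Proof.
move=> r0 yV Vy xy; case: j => i; first exact: scommX.
have -> : r ^ Negz i = r^-1 ^+ i.+1 by rewrite exprVn.
exact: scommX (scomm_inv r0 yV Vy xy).
Qed.

Lemma pcls_iter t i : pcls rel (iter i (Mul t) (Cst 1)) = pcls rel t ^+ i.
Proof. by elim: i => [|i IHi] //=; rewrite pclsM IHi exprS. Qed.

Lemma smallest_subalgebra (X : set A) : subalgebra (smallest (@subalgebra k G rel) X).
Proof.
split=> [|x y Sx Sy|x y Sx Sy|c x Sx] B SB; have [[B1 BD BM BZ] _] := SB => //.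
- by apply: BD; [exact: Sx | exact: Sy].
- by apply: BM; [exact: Sx | exact: Sy].
- by apply: BZ; exact: Sx.
Qed.

Lemma subalgebra_centraliser y : subalgebra [set x : A | GRing.comm x y].
Proof.
split=> /= [|x z xy zy|x z xy zy|c x xy]; rewrite /GRing.comm.
- by rewrite mul1r mulr1.
- by rewrite mulrDl mulrDr xy zy.
- by rewrite -mulrA zy mulrA xy -mulrA.
- by rewrite -presAlg_scaleAl -presAlg_scaleAr xy.
Qed.

End ScalarCommutation.

(** * Simple modules with weights shifted by a unit *)

Section ShiftedWeights.
Context {k : fieldType} {G : Type} {rel : pterm k G -> pterm k G -> Prop}.
Local Notation A := (presAlg rel).
Variables (q : k) (x xi y yi : A) (S : set A).
Hypotheses (q_neq0 : q != 0) (q_free : forall i : int, q ^ i = 1 -> i = 0).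
Hypotheses (Vx : xi * x = 1) (yV : y * yi = 1) (Vy : yi * y = 1).
Hypothesis xy : scomm q x y.
Hypotheses (algS : subalgebra S).
Hypothesis S_comm : forall z, S z -> GRing.comm z x /\ GRing.comm z y.
Hypothesis gen : forall B : set A, subalgebra B -> S `<=` B ->
  B x -> B xi -> B y -> B yi -> forall z, B z.
Variable V : lmodType A.
Local Notation wt := (weight_space V x).

Lemma lin_closed_module (U : set V) : is_module S U -> lin_closed U.
Proof.
move=> [U0 UD US]; split=> // c v; apply: US.
by have [S1 _ _ SZ] := algS; apply: SZ.
Qed.

Lemma weight_shift l i (u : V) : wt l u -> wt (q ^ i * l) (zpow y yi i *: u).
Proof.
rewrite /weight_space /= => xu.
rewrite scalerA (scomm_zpow i q_neq0 yV Vy xy) cst_scale -scalerA xu.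
by rewrite scaler_cst scalerA -cstM.
Qed.

Lemma weight_space_lin l : lin_closed (wt l).
Proof.
rewrite /weight_space; split=> /= [|u v xu xv|c v xv]; first by rewrite !scaler0.
  by rewrite !scalerDr xu xv.
by rewrite scaler_cst xv scaler_cst.
Qed.

Lemma weight_space_module l : is_module S (wt l).
Proof.
have [w0 wD _] := weight_space_lin l; split=> // z v Sz; rewrite /weight_space /=.
have [zx _] := S_comm Sz.
by move=> xv; rewrite scalerA -zx -scalerA xv scaler_cst.
Qed.

(** Eigenvectors for eigenvalues other than [l] cannot add up to a nonzero
    eigenvector for [l].
    The eigenvalues [g i] may repeat.  Applying [x - g i0] removes
    one term and multiplies [u] by the nonzero scalar [l - g i0]. *)
Lemma weight_sum_disjoint (I : eqType) (s : seq I) (f : I -> V) (g : I -> k) l u :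
    {in s, forall i, wt (g i) (f i) /\ g i != l} ->
  wt l u -> u = \sum_(i <- s) f i -> u = 0.
Proof.
elim: s f u => [|i0 s IHs] f u fg; first by rewrite big_nil.
move=> ul; rewrite big_cons => uE.
have [fi0 gi0] := fg i0 (mem_head _ _).
apply: (@cst_inj _ _ _ _ (l - g i0)); first by rewrite subr_eq0 eq_sym.
pose c m := ((m - g i0) *: (1 : A)).
have cP m v : wt m v -> c m *: v = (x - g i0 *: (1 : A)) *: v.
  by rewrite /weight_space /= /c !scalerBl => ->.
apply: (IHs (fun i => c (g i) *: f i)).
- move=> i si; have [fi gi] := fg i (mem_behead (si : i \in behead (i0 :: s))).
  by split=> //; have [_ _] := weight_space_lin (g i); apply.
- by have [_ _] := weight_space_lin l; apply.
rewrite -[_ *: (1 : A)]/(c l) (cP _ _ ul) uE scalerDr -(cP _ _ fi0) /c subrr scale0r scale0r add0r.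
rewrite scaler_sumr; apply: eq_big_seq => i si.
by have [fi _] := fg i (mem_behead (si : i \in behead (i0 :: s))); rewrite -(cP _ _ fi).
Qed.

Definition shift_span (U : set V) : set V :=
  [set v | exists s : seq (int * V), {in s, forall p, U p.2} /\
     v = \sum_(p <- s) zpow y yi p.1 *: p.2].

(** It suffices to check an additive property on the summands y^i U. *)
Lemma shift_span_ind (U : set V) (P : V -> Prop) : P 0 ->
    (forall u v, P u -> P v -> P (u + v)) ->
    (forall i u, U u -> P (zpow y yi i *: u)) ->
  forall v, shift_span U v -> P v.
Proof.
move=> P0 PD PU _ [s [sU ->]]; rewrite big_seq.
by elim/big_ind: _ => // p /sU; apply: PU.
Qed.

Lemma shift_span_sub (U : set V) i u : U u -> shift_span U (zpow y yi i *: u).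
Proof.
move=> Uu; exists [:: (i, u)]; rewrite big_seq1; split=> // p.
by rewrite inE => /eqP->.
Qed.

Lemma shift_span0 (U : set V) : shift_span U 0.
Proof. by exists [::]; rewrite big_nil. Qed.

Lemma shift_spanD (U : set V) u v :
  shift_span U u -> shift_span U v -> shift_span U (u + v).
Proof.
move=> [s [sU ->]] [t [tU ->]]; exists (s ++ t); rewrite big_cat; split=> // p.
by rewrite mem_cat => /orP[/sU | /tU].
Qed.

(** The elements of [A] that preserve the sum of the y^i U form a subalgebra, so
    only the generators need a check: those in [S] commute with [y], and [x] and
    its inverse act on y^i U by nonzero scalars. *)
Lemma shift_span_module l (U : set V) : l != 0 -> U `<=` wt l -> is_module S U ->
  is_module [set: A] (shift_span U).
Proof.
move=> l0 Ul [U0 UD US]; pose W := shift_span U.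
have W0 : W 0 := shift_span0 U; have WD := @shift_spanD U.
(* B is the set of the elements that preserve W. *)
pose B := [set z : A | forall v, W v -> W (z *: v)].
have BP z : (forall i u, U u -> W (z *: (zpow y yi i *: u))) -> B z.
  move=> zU; apply: shift_span_ind => //; first by rewrite scaler0.
  by move=> u v Wu Wv; rewrite scalerDr; apply: WD.
have SB : S `<=` B.
  move=> z Sz; apply: BP => i u Uu; have [_ zy] := S_comm Sz.
  rewrite scalerA (comm_zpow yV Vy i zy) -scalerA.
  exact/shift_span_sub/US.
have cB c : B (c *: (1 : A)).
  by apply: SB; have [S1 _ _ SZ] := algS; apply: SZ.
have algB : subalgebra B.
  split=> [v|z t Bz Bt v Wv|z t Bz Bt v Wv|c z Bz v Wv].
  - by rewrite scale1r.
  - by rewrite scalerDl; apply: WD; [apply: Bz | apply: Bt].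
  - by rewrite -scalerA; apply/Bz/Bt.
  - by rewrite cst_scale; apply/cB/Bz.
split=> // z v _; apply: (gen algB SB); apply: BP => i u Uu.
- rewrite (weight_shift i (Ul _ Uu)); apply: cB; exact: shift_span_sub.
- have xw := weight_shift i (Ul _ Uu); set w := zpow _ _ _ *: u in xw *.
  have ql0 : q ^ i * l != 0 by rewrite mulf_neq0 // expfz_neq0.
  have -> : xi *: w = ((q ^ i * l)^-1 *: (1 : A)) *: w; last first.
    by apply/cB/shift_span_sub.
  apply: (canRL (g := fun v => ((q ^ i * l)^-1 *: (1 : A)) *: v)
                (f := fun v => ((q ^ i * l) *: (1 : A)) *: v)) => [v'|].
    by rewrite scalerA -cstM mulVf // scale1r scale1r.
  by rewrite scalerA cst_central -scalerA -xw scalerA Vx scale1r.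
- rewrite scalerA -zpowS // addrC; exact: shift_span_sub.
- rewrite scalerA -zpowB1 //; exact: shift_span_sub.
Qed.

(** The terms with i <> 0 have weights q^i l <> l, so they cannot contribute to
    an element of weight [l]. *)
Lemma shift_span_weight l (U : set V) : l != 0 -> U `<=` wt l -> is_module S U ->
  forall v, shift_span U v -> wt l v -> U v.
Proof.
move=> l0 Ul [U0 UD US] v [s [sU vE]] vl.
(* u is the part of v that lies in U; v - u is a sum of other weights. *)
pose u := \sum_(p <- s | p.1 == 0) zpow y yi p.1 *: p.2.
have Uu : U u.
  rewrite /u big_seq_cond; elim/big_ind: _ => // p /andP[/sU Up /eqP->] /=.
  by rewrite expr0 scale1r.
suff -> : v = u by [].
apply/eqP; rewrite -subr_eq0; apply/eqP.
apply: (@weight_sum_disjoint _ [seq p <- s | p.1 != 0]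
  (fun p => zpow y yi p.1 *: p.2) (fun p => q ^ p.1 * l) l).
- move=> p; rewrite mem_filter => /andP[p0 /sU/Ul up].
  split; first exact: weight_shift.
  apply: contra p0 => /eqP ql; apply/eqP/q_free.
  by apply: (mulIf l0); rewrite ql mul1r.
- have [_ wD wZ] := weight_space_lin l.
  apply: wD => //; rewrite -scaleN1r -[-1](scale1r (-1 : A)).
  by rewrite scalerN -scaleNr; apply/wZ/Ul.
by rewrite big_filter vE (bigID (fun p => p.1 == 0)) /= -/u addrAC subrr add0r.
Qed.

(** By simplicity, the shifts of any nonzero [S]-submodule of a weight space span
    [V].  Taken with the whole space this bounds the support; taken with an
    arbitrary submodule it gives simplicity over [S]. *)
Theorem simple_weight_module :
    is_simple [set: A] [set: V] -> weight_module V x ->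
  exists l : k, [/\ l != 0,
    weight_supp V x = [set q ^ i * l | i in [set: int]]
  & forall i : int, is_simple S (wt (q ^ i * l))].
Proof.
move=> [_ V0 Vsimple] [Vgen _].
have span_all l U : l != 0 -> U `<=` wt l -> is_module S U -> U <> [set 0] ->
    forall v, shift_span U v.
  move=> l0 Ul modU Un0 v.
  case: (Vsimple (shift_span U)) => // [|W0|->] //.
    exact: shift_span_module Ul modU.
  case: Un0; apply/seteqP; split=> u /=; last by move=> ->; case: modU.
  by move=> /(shift_span_sub 0); rewrite W0 /= expr0 scale1r.
have [l [l0 wl0]] : exists l, l != 0 /\ wt l <> [set 0].
  apply: contrapT => noL; apply: V0; apply/seteqP; split=> v // _ /=.
  have [s [f [[_ sf] ->]]] := Vgen v.
  rewrite big_seq big1 // => i /sf[/= i0 fi]; apply: contrapT => fi0.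
  by apply: noL; exists i; split=> // wi; apply: fi0; move: fi; rewrite wi.
have ql0 i : q ^ i * l != 0 by rewrite mulf_neq0 // expfz_neq0.
have wt_shift i : wt (q ^ i * l) <> [set 0].
  move=> wi; apply: wl0; apply/seteqP; split=> v /=; last first.
    by move=> ->; case: (weight_space_lin l).
  move=> /(weight_shift i); rewrite wi /= => /(congr1 (fun w => zpow y yi (- i) *: w)).
  by rewrite scaler0 scalerA -(mulr1 (_ * _)) -mulrA zpowNK // scale1r.
exists l; split=> //.
  apply/seteqP; split=> [m [m0 wm]|_ [i _ <-]] //; apply: contrapT => notin.
  apply: wm; apply/seteqP; split=> v /=; last first.
    by move=> ->; case: (weight_space_lin m).
  have [s [sU vE]] := span_all l _ l0 (@subset_refl _ _) (weight_space_module l) wl0 v.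
  move=> vm; apply: (weight_sum_disjoint _ vm vE (g := fun p => q ^ p.1 * l)) => p sp.
  split; first exact/weight_shift/sU.
  by apply/eqP => qm; apply: notin; exists p.1.
move=> i; split=> //; first exact: weight_space_module.
move=> U Ui modU; have [->|Un0] := pselect (U = [set 0]); [by left | right].
apply/seteqP; split=> // v vi; apply: (shift_span_weight (ql0 i) Ui modU) => //.
exact: span_all Ui modU Un0 _.
Qed.

End ShiftedWeights.

(** * Relations in the Heisenberg double *)

Section HeisenbergRelations.
Variables (k : fieldType) (q : k) (m n : int).
Hypothesis q_neq0 : q != 0.

Local Notation D := (hdouble q m n).
Local Notation a := (hd q m n ga).
Local Notation ai := (hd q m n gai).
Local Notation b := (hd q m n gb).
Local Notation c := (hd q m n gc).
Local Notation K := (hd q m n gK).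
Local Notation Ki := (hd q m n gKi).
Local Notation E := (hd q m n gE).
Local Notation F := (hd q m n gF).
Local Notation aP := (hd_apow q m n).
Local Notation KP := (hd_Kpow q m n).
Implicit Types (x y z : D) (e f i j : int).

Definition qcomm e x y := scomm (q ^ e) x y.

Lemma qcomm_eq e f x y : qcomm e x y -> e = f -> qcomm f x y.
Proof. by move=> ? <-. Qed.

Lemma qcomm_sym e x y : qcomm e x y -> qcomm (- e) y x.
Proof. by move=> /(scomm_sym (expfz_neq0 e q_neq0)); rewrite /qcomm invr_expz. Qed.

Lemma qcommMr e f x y z : qcomm e x y -> qcomm f x z -> qcomm (e + f) x (y * z).
Proof. by rewrite /qcomm expfzDr //; apply: scommMr. Qed.

Lemma qcommMl e f x y z : qcomm e x z -> qcomm f y z -> qcomm (e + f) (x * y) z.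
Proof. by rewrite /qcomm expfzDr //; apply: scommMl. Qed.

Lemma qcomm0 x y : qcomm 0 x y <-> x * y = y * x.
Proof. by rewrite /qcomm /scomm expr0z scale1r. Qed.

Lemma hd_relE s t : hd_rel q m n s t -> pcls (hd_rel q m n) s = pcls _ t.
Proof. exact: pcls_rel. Qed.

Lemma hd_aV : a * ai = 1. Proof. by rewrite -pclsM (hd_relE (rel_aV _ _ _)). Qed.
Lemma hd_Va : ai * a = 1. Proof. by rewrite -pclsM (hd_relE (rel_Va _ _ _)). Qed.
Lemma hd_KV : K * Ki = 1. Proof. by rewrite -pclsM (hd_relE (rel_KV _ _ _)). Qed.
Lemma hd_VK : Ki * K = 1. Proof. by rewrite -pclsM (hd_relE (rel_VK _ _ _)). Qed.

Lemma hd_apowE j : aP j = zpow a ai j.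
Proof. by case: j => i; rewrite /zpow -pcls_iter. Qed.

Lemma hd_KpowE j : KP j = zpow K Ki j.
Proof. by case: j => i; rewrite /zpow -pcls_iter. Qed.

Lemma hd_apowD i j : aP (i + j) = aP i * aP j.
Proof. by rewrite !hd_apowE zpowD ?hd_aV ?hd_Va. Qed.

Lemma hd_KpowD i j : KP (i + j) = KP i * KP j.
Proof. by rewrite !hd_KpowE zpowD ?hd_KV ?hd_VK. Qed.

Lemma hd_apow0 : aP 0 = 1. Proof. by rewrite hd_apowE. Qed.
Lemma hd_Kpow0 : KP 0 = 1. Proof. by rewrite hd_KpowE. Qed.

Lemma qcomm_apow e x j : qcomm e x a -> qcomm (e * j) x (aP j).
Proof.
move=> xa; rewrite /qcomm hd_apowE -exprz_exp.
by apply: scomm_zpow => //; rewrite ?expfz_neq0 ?hd_aV ?hd_Va.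
Qed.

Lemma qcomm_Kpow e x j : qcomm e x K -> qcomm (e * j) x (KP j).
Proof.
move=> xK; rewrite /qcomm hd_KpowE -exprz_exp.
by apply: scomm_zpow => //; rewrite ?expfz_neq0 ?hd_KV ?hd_VK.
Qed.

Lemma qcomm_rel e (g h : hd_gen) :
  hd_rel q m n (Mul (Gen g) (Gen h)) (Mul (Cst (q ^ e)) (Mul (Gen h) (Gen g))) ->
  qcomm e (hd q m n g) (hd q m n h).
Proof. by move=> gh; rewrite /qcomm /scomm -!pclsM -pclsZ (hd_relE gh). Qed.

Lemma qcomm_rel0 (g h : hd_gen) :
  hd_rel q m n (Mul (Gen g) (Gen h)) (Mul (Gen h) (Gen g)) ->
  qcomm 0 (hd q m n g) (hd q m n h).
Proof. by move=> gh; apply/qcomm0; rewrite -!pclsM (hd_relE gh). Qed.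

Lemma qcomm_ba : qcomm (- n) b a.
Proof. exact: qcomm_sym (qcomm_rel (rel_ab _ _ _)). Qed.
Lemma qcomm_ca : qcomm (- m) c a.
Proof. exact: qcomm_sym (qcomm_rel (rel_ac _ _ _)). Qed.
Lemma qcomm_Ea : qcomm 0 E a. Proof. exact: qcomm_rel0 (rel_Ea _ _ _). Qed.
Lemma qcomm_Fa : qcomm n F a. Proof. exact: qcomm_rel (rel_Fa _ _ _). Qed.
Lemma qcomm_Ka : qcomm (- 1) K a. Proof. exact: qcomm_rel (rel_Ka _ _ _). Qed.
Lemma qcomm_bK : qcomm (- n) b K.
Proof. exact: qcomm_sym (qcomm_rel (rel_Kb _ _ _)). Qed.
Lemma qcomm_cK : qcomm (- - m) c K.
Proof. exact: qcomm_sym (qcomm_rel (rel_Kc _ _ _)). Qed.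
Lemma qcomm_EK : qcomm (- (2 * m)) E K.
Proof. exact: qcomm_sym (qcomm_rel (rel_KE _ _ _)). Qed.
Lemma qcomm_FK : qcomm (- - (2 * n)) F K.
Proof. exact: qcomm_sym (qcomm_rel (rel_KF _ _ _)). Qed.
Lemma qcomm_EF : qcomm 0 E F. Proof. exact: qcomm_rel0 (rel_EF _ _ _). Qed.

Lemma hd_Ec : E * c = c * E + aP (- m) * KP m.
Proof. by rewrite -!pclsM -pclsD (hd_relE (rel_Ec _ _ _)). Qed.

Lemma hd_Fb : F * b = q ^ (- (n ^+ 2)) *: (b * F) + aP n.
Proof. by rewrite -!pclsM -pclsZ -pclsD (hd_relE (rel_Fb _ _ _)). Qed.

Lemma qcomm_aa j : qcomm 0 (aP j) a.
Proof.
apply: qcomm_eq (qcomm_sym (qcomm_apow j (e := 0) _)) _; last by rewrite mul0r oppr0.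
exact/qcomm0.
Qed.

Lemma qcomm_aK j : qcomm j (aP j) K.
Proof. by apply: qcomm_eq (qcomm_sym (qcomm_apow j qcomm_Ka)) _; ring. Qed.

Lemma qcomm_KK j : qcomm 0 (KP j) K.
Proof.
apply: qcomm_eq (qcomm_sym (qcomm_Kpow j (e := 0) _)) _; last by rewrite mul0r oppr0.
exact/qcomm0.
Qed.

Lemma qcomm_KPa j : qcomm (- j) (KP j) a.
Proof.
by apply: qcomm_eq (qcomm_sym (qcomm_Kpow j (qcomm_sym qcomm_Ka))) _; ring.
Qed.

Lemma qcommZl e (r : k) x y : qcomm e x y -> qcomm e (r *: x) y.
Proof.
rewrite /qcomm /scomm => xy; rewrite -presAlg_scaleAl xy -presAlg_scaleAr.
by rewrite !scalerA mulrC.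
Qed.

Lemma qcommZr e (r : k) x y : qcomm e x y -> qcomm e x (r *: y).
Proof.
by move=> /qcomm_sym/(qcommZl r)/qcomm_sym; rewrite opprK.
Qed.

Let b' := hd_b' q m n.
Let c' := hd_c' q m n.
Let E' := hd_E' q m n.
Let F' := hd_F' q m n.

(** Computes the exponent e with x y = q^e y x for monomials x, y in the
    generators by adding the exponents of all pairs of factors; [c, E] and
    [b, F] are the pairs that do not commute up to a scalar. *)
Ltac qcomm_step :=
  lazymatch goal with
  | |- qcomm _ (_ *: _) _ => eapply qcommZl
  | |- qcomm _ _ (_ *: _) => eapply qcommZr
  | |- qcomm _ (_ * _) _ => eapply qcommMl
  | |- qcomm _ _ (_ * _) => eapply qcommMr
  | |- qcomm _ _ (hd_apow _ _ _ _) => eapply qcomm_apow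
  | |- qcomm _ _ (hd_Kpow _ _ _ _) => eapply qcomm_Kpow
  | |- qcomm _ (hd_apow _ _ _ _) (hd _ _ _ ga) => exact: qcomm_aa
  | |- qcomm _ (hd_apow _ _ _ _) (hd _ _ _ gK) => exact: qcomm_aK
  | |- qcomm _ (hd_Kpow _ _ _ _) (hd _ _ _ ga) => exact: qcomm_KPa
  | |- qcomm _ (hd_Kpow _ _ _ _) (hd _ _ _ gK) => exact: qcomm_KK
  | |- qcomm _ (hd_apow _ _ _ _) _ => eapply qcomm_sym
  | |- qcomm _ (hd_Kpow _ _ _ _) _ => eapply qcomm_sym
  | |- qcomm _ (hd _ _ _ gb) (hd _ _ _ ga) => exact: qcomm_ba
  | |- qcomm _ (hd _ _ _ gc) (hd _ _ _ ga) => exact: qcomm_ca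
  | |- qcomm _ (hd _ _ _ gE) (hd _ _ _ ga) => exact: qcomm_Ea
  | |- qcomm _ (hd _ _ _ gF) (hd _ _ _ ga) => exact: qcomm_Fa
  | |- qcomm _ (hd _ _ _ gb) (hd _ _ _ gK) => exact: qcomm_bK
  | |- qcomm _ (hd _ _ _ gc) (hd _ _ _ gK) => exact: qcomm_cK
  | |- qcomm _ (hd _ _ _ gE) (hd _ _ _ gK) => exact: qcomm_EK
  | |- qcomm _ (hd _ _ _ gF) (hd _ _ _ gK) => exact: qcomm_FK
  | |- qcomm _ (hd _ _ _ gE) (hd _ _ _ gF) => exact: qcomm_EF
  end.
Ltac qcomm_calc := eapply qcomm_eq; [repeat qcomm_step | ring].

Lemma hd_S_comm z : hd_S q m n z -> GRing.comm z a /\ GRing.comm z K.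
Proof.
move=> Sz; split.
  have S_a : subalgebra [set x : D | GRing.comm x a] := subalgebra_centraliser a.
  apply: (smallest_sub S_a _ Sz) => _ [] ->; apply/qcomm0.
  - rewrite /hd_b'; qcomm_calc.
  - rewrite /hd_c'; qcomm_calc.
  - rewrite /hd_E'; qcomm_calc.
  - rewrite /hd_F'; qcomm_calc.
have S_K : subalgebra [set x : D | GRing.comm x K] := subalgebra_centraliser K.
apply: (smallest_sub S_K _ Sz) => _ [] ->; apply/qcomm0.
- rewrite /hd_b'; qcomm_calc.
- rewrite /hd_c'; qcomm_calc.
- rewrite /hd_E'; qcomm_calc.
- rewrite /hd_F'; qcomm_calc.
Qed.

Lemma hd_E'F' : scomm (q ^ (- (2 * m * n))) E' F'.
Proof.
rewrite -/(qcomm _ _ _) /E' /F' /hd_E' /hd_F'.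
qcomm_calc.
Qed.

Lemma hd_apowNK j z : aP (- j) * (aP j * z) = z.
Proof. by rewrite !hd_apowE zpowNK ?hd_aV ?hd_Va. Qed.
Lemma hd_apowKN j z : aP j * (aP (- j) * z) = z.
Proof. by rewrite !hd_apowE zpowKN ?hd_aV ?hd_Va. Qed.
Lemma hd_KpowNK j z : z * KP (- j) * KP j = z.
Proof. by rewrite -mulrA -hd_KpowD addNr hd_Kpow0 mulr1. Qed.
Lemma hd_KpowKN j z : z * KP j * KP (- j) = z.
Proof. by rewrite -mulrA -hd_KpowD subrr hd_Kpow0 mulr1. Qed.

(** The definitions of b', c', E', F' can be solved for b, c, E, F with powers of
    a and K as coefficients. *)
Lemma hd_generated_by_S (B : set D) : subalgebra B -> hd_S q m n `<=` B ->
  B K -> B Ki -> B a -> B ai -> forall z, B z.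
Proof.
move=> [B1 BD BM BZ] SB BK BKi Ba Bai.
have BX x (i : nat) : B x -> B (x ^+ i).
  by move=> Bx; elim: i => // i IHi; rewrite exprS; apply: BM.
have BaP j : B (aP j) by rewrite hd_apowE; case: j => i; apply: BX.
have BKP j : B (KP j) by rewrite hd_KpowE; case: j => i; apply: BX.
have gens : [set x | [\/ x = b', x = c', x = E' | x = F']] `<=` B.
  by move=> x xg; apply: SB; apply: sub_gen_smallest.
have Bb' : B b' by apply: gens; constructor 1.
have Bc' : B c' by apply: gens; constructor 2.
have BE' : B E' by apply: gens; constructor 3.
have BF' : B F' by apply: gens; constructor 4.
move=> z; rewrite -(preprK z); elim: (prepr z) => [g|r|s Bs t Bt|s Bs t Bt]; last first.
- by rewrite pclsM; apply: BM.
- by rewrite pclsD; apply: BD.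
- by rewrite pclsC; apply: BZ.
rewrite -/(hd q m n g); case: g => //.
- have -> : b = aP (- n) * b' * KP n.
    by rewrite /b' /hd_b' -(mulrA (aP n)) hd_apowNK hd_KpowNK.
  by apply: (BM) => //; apply: BM.
- have -> : c = aP m * c' * KP m.
    by rewrite /c' /hd_c' -(mulrA (aP (- m))) hd_apowKN hd_KpowNK.
  by apply: (BM) => //; apply: BM.
- by rewrite -(hd_apowNK (2 * m) E); apply: BM.
have -> : F = q ^ (n ^+ 2) *: (aP (2 * n) * F' * KP (- n)).
  rewrite /F' /hd_F' -presAlg_scaleAr -presAlg_scaleAl scalerA -expfzDr //.
  by rewrite subrr scale1r -(mulrA (aP (- _))) hd_apowKN hd_KpowKN.
by apply: BZ; apply: (BM) => //; apply: BM.
Qed.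

(** Both products reduce to a normal form: E' c' = a^m (E c) K^-m, while c' E' is
    a power of q times a^m c E K^-m; then E c = c E + a^-m K^m gives the 1. *)
Lemma hd_E'c' : E' * c' = 1 + q ^ (2 * m ^+ 2) *: (c' * E').
Proof.
have aE j : E * aP j = aP j * E by apply/qcomm0; qcomm_calc.
have -> : E' * c' = aP m * (E * c) * KP (- m).
  rewrite /E' /c' /hd_E' /hd_c' !mulrA -(mulrA (aP _) E) aE !mulrA -hd_apowD.
  by congr (aP _ * _ * _ * _); ring.
have -> : c' * E' = q ^ (- (2 * m ^+ 2)) *: (aP m * c * E * KP (- m)).
  have cKa : c * KP (- m) * aP (2 * m) = aP (2 * m) * (c * KP (- m)).
    by apply/qcomm0; qcomm_calc.
  have KE : qcomm (- (2 * m ^+ 2)) (KP (- m)) E.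
    by apply: qcomm_eq (qcomm_sym (qcomm_Kpow (- m) qcomm_EK)) _; ring.
  rewrite /E' /c' /hd_E' /hd_c' -(mulrA (aP _) c) -mulrA (mulrA _ _ E) cKa.
  rewrite !mulrA -hd_apowD -(mulrA _ _ E) KE -presAlg_scaleAr !mulrA.
  by congr (_ *: (aP _ * _ * _ * _)); ring.
rewrite scalerA -expfzDr // subrr scale1r hd_Ec mulrDr mulrDl addrC !mulrA.
by rewrite -hd_apowD subrr hd_apow0 mul1r -hd_KpowD subrr hd_Kpow0.
Qed.

(** The same with F' b' = a^-n (F b), b' F' = q^(n^2) a^-n b F and the relation
    for F b.  The factor q^(-n^2) in F' makes the constant term equal to 1. *)
Lemma hd_F'b' : F' * b' = 1 + q ^ (- (2 * n ^+ 2)) *: (b' * F').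
Proof.
have Kab : KP n * (aP n * b) = aP n * b * KP n.
  by apply/esym/qcomm0; qcomm_calc.
have Fan : F * aP n = q ^ (n ^+ 2) *: (aP n * F).
  suff : qcomm (n ^+ 2) F (aP n) by []. qcomm_calc.
have -> : F' * b' = aP (- n) * (F * b).
  rewrite /F' /b' /hd_F' /hd_b' -presAlg_scaleAl -!mulrA (mulrA _ _ (KP (- n))).
  rewrite (mulrA (KP n)) Kab hd_KpowKN (mulrA F) Fan -presAlg_scaleAl -presAlg_scaleAr.
  rewrite scalerA -expfzDr // addNr scale1r !mulrA -hd_apowD.
  by congr (aP _ * _ * _); ring.
have -> : b' * F' = q ^ (n ^+ 2) *: (aP (- n) * b * F).
  have KaF : KP (- n) * (aP (- (2 * n)) * F) = aP (- (2 * n)) * F * KP (- n).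
    by apply/esym/qcomm0; qcomm_calc.
  have ba : b * aP (- (2 * n)) = q ^ (2 * n ^+ 2) *: (aP (- (2 * n)) * b).
    suff : qcomm (2 * n ^+ 2) b (aP (- (2 * n))) by []. qcomm_calc.
  rewrite /F' /b' /hd_F' /hd_b' -presAlg_scaleAr -!mulrA.
  rewrite (mulrA (aP _) F) (mulrA (KP (- n))) KaF hd_KpowNK.
  rewrite (mulrA b) ba -presAlg_scaleAl -presAlg_scaleAr scalerA -expfzDr //.
  rewrite !mulrA -hd_apowD.
  by congr (q ^ _ *: (aP _ * _ * _)); ring.
rewrite hd_Fb mulrDr -hd_apowD addNr hd_apow0 addrC; congr (_ + _).
rewrite -presAlg_scaleAr scalerA -expfzDr // mulrA.
by congr (q ^ _ *: _); ring.
Qed.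

(** * Weight modules over the Heisenberg double *)

Hypothesis q_free : forall i : int, q ^ i = 1 -> i = 0.
Hypotheses (m_neq0 : m != 0) (n_neq0 : n != 0).

Lemma hd_S_algebra : subalgebra (hd_S q m n).
Proof. exact: smallest_subalgebra. Qed.

Lemma expfz_not_root1 e (j : nat) : e != 0 -> (0 < j)%N -> (q ^ e) ^+ j != 1.
Proof.
move=> e0 j0; apply/eqP; rewrite -[_ ^+ _]/((q ^ e) ^ j%:Z) exprz_exp => /q_free.
by move/eqP; rewrite mulf_eq0 (negPf e0) /=; case: j j0.
Qed.

(** The exponents 2 m^2, -2 n^2 and -2 m n are nonzero, so the three scalars in
    the relations are not roots of unity. *)
Lemma hd_S_module_infinite_dim (V : lmodType D) (U : set V) :
  is_module (hd_S q m n) U -> U <> [set 0] -> ~ finite_dim U.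
Proof.
move=> modU Un0; have gS x : [\/ x = b', x = c', x = E' | x = F'] -> hd_S q m n x.
  by move=> xg; apply: sub_gen_smallest.
have [_ _ US] := modU.
apply: (qweyl_pair_infinite_dim (lin_closed_module hd_S_algebra modU) Un0 _ _ _
  _ _ _ hd_E'c' hd_F'b' hd_E'F').
- move=> v Uv; split; apply: US => //; apply: gS;
    by [constructor 3 | constructor 2 | constructor 4 | constructor 1].
- exact: expfz_neq0.
- exact: expfz_neq0.
- by move=> j; apply: expfz_not_root1; rewrite mulf_neq0 // expf_neq0.
- by move=> j; apply: expfz_not_root1; rewrite oppr_eq0 mulf_neq0 // expf_neq0.
- by move=> j; apply: expfz_not_root1; rewrite oppr_eq0 !mulf_neq0.
Qed.

Lemma hd_scomm_aK : scomm q a K.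
Proof. by have := qcomm_sym qcomm_Ka; rewrite /qcomm opprK expr1z. Qed.

Lemma hd_scomm_Kai : scomm q K ai.
Proof.
have := scomm_inv (expfz_neq0 (- 1) q_neq0) hd_aV hd_Va qcomm_Ka.
by rewrite invr_expz opprK expr1z.
Qed.

(** Here the shift is by [ai], since K a^-1 = q a^-1 K. *)
Lemma hd_simple_weight_K (V : lmodType D) :
    is_simple [set: D] [set: V] -> weight_module V K ->
  (exists l : k, [/\ l != 0,
     weight_supp V K = [set q ^ i * l | i in [set: int]]
   & forall i : int, is_simple (hd_S q m n) (weight_space V K (q ^ i * l))]) /\
  (forall l : k, weight_supp V K l -> ~ finite_dim (weight_space V K l)).
Proof.
have S_comm z : hd_S q m n z -> GRing.comm z K /\ GRing.comm z ai.
  move=> /hd_S_comm[za zK]; split=> //.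
  exact: (comm_zpow hd_aV hd_Va (- 1) za).
move=> simpleV weightV; split.
  apply: (simple_weight_module q_neq0 q_free hd_VK hd_Va hd_aV hd_scomm_Kai
            hd_S_algebra S_comm) => // B algB SB BK BKi Bai Ba.
  exact: hd_generated_by_S.
move=> l [_ Vl]; apply: hd_S_module_infinite_dim Vl.
exact: weight_space_module S_comm _ _.
Qed.

Lemma hd_simple_weight_a (V : lmodType D) :
    is_simple [set: D] [set: V] -> weight_module V a ->
  (exists l : k, [/\ l != 0,
     weight_supp V a = [set q ^ i * l | i in [set: int]]
   & forall i : int, is_simple (hd_S q m n) (weight_space V a (q ^ i * l))]) /\
  (forall l : k, weight_supp V a l -> ~ finite_dim (weight_space V a l)).
Proof.
move=> simpleV weightV; split.
  apply: (simple_weight_module q_neq0 q_free hd_Va hd_KV hd_VK hd_scomm_aK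
            hd_S_algebra hd_S_comm) => // B algB SB Ba Bai BK BKi.
  exact: hd_generated_by_S.
move=> l [_ Vl]; apply: hd_S_module_infinite_dim Vl.
exact: weight_space_module hd_S_comm _ _.
Qed.

End HeisenbergRelations.

Theorem theorem2p4 (k : closedFieldType) (k_char0 : [pchar k] =i pred0)
    (q : k) (q_neq0 : q != 0)
    (q_not_root1 : forall j : nat, (0 < j)%N -> q ^+ j != 1)
    (m n : int) (m_neq0 : m != 0) (n_neq0 : n != 0) :
  (forall V : lmodType (hdouble q m n),
     is_simple [set: hdouble q m n] [set: V] ->
     weight_module V (hd q m n gK) ->
     (exists l : k,
        [/\ l != 0,
            weight_supp V (hd q m n gK) = [set q ^ i * l | i in [set: int]]
          & forall i : int,
              is_simple (hd_S q m n)
                (weight_space V (hd q m n gK) (q ^ i * l))]) /\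
     (forall l : k, weight_supp V (hd q m n gK) l ->
        ~ finite_dim (weight_space V (hd q m n gK) l)))
  /\
  (forall W : lmodType (hdouble q m n),
     is_simple [set: hdouble q m n] [set: W] ->
     weight_module W (hd q m n ga) ->
     (exists u : k,
        [/\ u != 0,
            weight_supp W (hd q m n ga) = [set q ^ i * u | i in [set: int]]
          & forall i : int,
              is_simple (hd_S q m n)
                (weight_space W (hd q m n ga) (q ^ i * u))]) /\
     (forall u : k, weight_supp W (hd q m n ga) u ->
        ~ finite_dim (weight_space W (hd q m n ga) u))).
Proof.
have q_free i : q ^ i = 1 -> i = 0.
  case: i => j qj; last first.
    by have := q_not_root1 j.+1 isT; rewrite -invr_eq1 -[_^-1]/(q ^ Negz j) qj eqxx.
  case: j qj => // j qj.
  by have := q_not_root1 j.+1 isT; rewrite -[q ^+ _]/(q ^ Posz j.+1) qj eqxx.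
split=> V; first exact: hd_simple_weight_K.
exact: hd_simple_weight_a.
Qed.
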